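(* Let $(X,\mathrm{dist})$ be a compact metric space, let $f:X\to X$ be a homeomorphism, and let $V,W$ be continuous nonnegative functions defined on a closed neighborhood of the diagonal of $X\times X$ such that $V(p,p)=W(p,p)=0$ for all $p\in X$. Assume that conditions (C1)–(C9) listed in the context are satisfied. Then $f$ has the finite shadowing property on $X$: for any $\varepsilon>0$ there exists $d>0$ (depending on $\varepsilon$ only) such that for every finite sequence $p_0,\dots,p_m\in X$ with $\mathrm{dist}(p_{k+1},f(p_k))<d$ for $0\le k\le m-1$, there is a point $r\in X$ with $\mathrm{dist}(f^k(r),p_k)<\varepsilon$ for $0\le k\le m$.
   Context: Arguments of $V$ and $W$ are always assumed close enough that the functions are defined; in particular, the points $q$ in the sets below are such that $(q,p)$ lies in the domain of $V$ and $W$. $B(\varepsilon,p)$ is the open $\varepsilon$-ball centered at $p$. A subset $A\subset B$ is a retract of $B$ if there is a continuous map (retraction) $B\to A$ that is the identity on $A$. For $a,b>0$ and $p\in X$ set $$P(a,b,p)=\{q\in X: V(q,p)\le a,\ W(q,p)\le b\},$$ $$Q(a,b,p)=\{q\in P(a,b,p): V(q,p)=a\},\qquad T(a,b,p)=\{q\in P(a,b,p): V(q,p)=0\},$$ $$\mathrm{Int}^0 P(a,b,p)=\{q\in P(a,b,p): V(q,p)<a,\ W(q,p)<b\},$$ $$\partial^0 P(a,b,p)=Q(a,b,p)\cup\{q\in P(a,b,p): W(q,p)=b\},$$ $$\mathrm{Int}^0 Q(a,b,p)=\{q\in P(a,b,p): V(q,p)=a,\ W(q,p)<b\}.$$ The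 conditions are: (C1) For any $\varepsilon>0$ there exists $\Delta_0=\Delta_0(\varepsilon)>0$ such that $P(\Delta_0,\Delta_0,p)\subset B(\varepsilon,p)$ for all $p\in X$. There exists $\Delta_1>0$ such that if $p\in X$, $\delta_1,\delta_2,\Delta<\Delta_1$ (positive numbers) and $\delta_2<\Delta$, then there exists a number $\alpha=\alpha(\delta_1,\delta_2,\Delta)>0$ such that: (C2) $Q(\delta_1,\delta_2,p)$ is not a retract of $P(\delta_1,\delta_2,p)$; (C3) $Q(\delta_1,\delta_2,p)$ is a retract of $P(\delta_1,\delta_2,p)\setminus T(\delta_1,\delta_2,p)$; (C4) there exists a retraction $\sigma:P(\delta_1,\Delta,p)\to P(\delta_1,\delta_2,p)$ such that $V(\sigma(q),p)\ge\alpha V(q,p)$ for $q\in P(\delta_1,\Delta,p)$. For any positive $\Delta<\Delta_1$ there exist positive numbers $\delta_1,\delta_2<\Delta$ such that the following hold for every $p\in X$: (C5) $f(P(\delta_1,\delta_2,p))\subset\mathrm{Int}^0 P(\Delta,\Delta,f(p))$ and $f^{-1}(P(\delta_1,\delta_2,f(p)))\subset\mathrm{Int}^0 P(\Delta,\Delta,p)$; (C6) $f(T(\delta_1,\delta_2,p))\subset\mathrm{Int}^0 P(\delta_1,\delta_2,f(p))$; (C7) $f(T(\delta_1,\Delta,p))\cap Q(\delta_1,\delta_2,f(p))=\emptyset$; (C8) $f(P(\delta_1,\delta_2,p))\cap\partial^0P(\delta_1,\delta_2,f(p))\subset\mathrm{Int}^0Q(\delta_1,\delta_2,f(p))$; (C9)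 $f(S(\delta_1,\Delta,p))\cap P(\delta_1,\delta_2,f(p))=\emptyset$, where $S(\delta_1,\Delta,p)=\{q\in P(\Delta,\Delta,p): V(q,p)\ge\delta_1\}$. *)

(* Defs.v *)
From HB Require Import structures.
From mathcomp Require Import all_boot all_order all_algebra.
From mathcomp Require Import all_classical all_reals all_analysis.
Export numFieldNormedType.Exports.

Set Implicit Arguments.
Unset Strict Implicit.
Unset Printing Implicit Defensive.

Import Order.TTheory GRing.Theory Num.Theory.

Local Open Scope classical_set_scope.
Local Open Scope ring_scope.

Definition homeomorphism (S T : topologicalType) (f : S -> T) : Prop :=
  continuous f /\ exists g : T -> S, [/\ continuous g, cancel f g & cancel g f].

(* A retraction B -> A is encoded by a total map s whose values outside B are
   irrelevant: its continuity is that of its restriction to the subspace B. *)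
Definition is_retraction (T : topologicalType) (A B : set T) (s : T -> T) :
    Prop :=
  [/\ A `<=` B, {within B, continuous s},
      (forall x, B x -> A (s x)) & (forall x, A x -> s x = x)].

Definition is_retract (T : topologicalType) (A B : set T) : Prop :=
  exists s : T -> T, is_retraction A B s.

Definition closed_nbhs_diagonal (T : topologicalType) (U : set (T * T)) :
    Prop :=
  closed U /\ forall p : T, nbhs (p, p) U.

Definition finite_shadowing (R : realType) (X : metricType R) (f : X -> X) :
    Prop :=
  forall eps : R, 0 < eps -> exists2 d : R, 0 < d &
    (* only the terms p 0, ..., p m of the sequence p matter *)
    forall (m : nat) (p : nat -> X),
      (forall k, (k < m)%N -> mdist (p k.+1) (f (p k)) < d) ->
      exists r : X, forall k, (k <= m)%N -> mdist (iter k f r) (p k) < eps.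

(* V and W are total functions, but only their values on U, the common domain
   of the two partial functions, are used: every set below consists of points
   q such that (q, p) is in U. *)
Section LyapunovSets.
Context (R : realType) (X : metricType R).
Context (U : set (X * X)) (V W : X * X -> R).
Implicit Types (a b : R) (p : X).

Definition Pset a b p : set X :=
  [set q | [/\ U (q, p), V (q, p) <= a & W (q, p) <= b]].

Definition Qset a b p : set X := [set q | Pset a b p q /\ V (q, p) = a].

Definition Tset a b p : set X := [set q | Pset a b p q /\ V (q, p) = 0].

Definition Int0P a b p : set X :=
  [set q | [/\ Pset a b p q, V (q, p) < a & W (q, p) < b]].

Definition bd0P a b p : set X :=
  Qset a b p `|` [set q | Pset a b p q /\ W (q, p) = b].

Definition Int0Q a b p : set X :=
  [set q | [/\ Pset a b p q, V (q, p) = a & W (q, p) < b]].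

Definition Sset a b p : set X := [set q | Pset b b p q /\ a <= V (q, p)].

Definition C1 : Prop :=
  forall eps : R, 0 < eps -> exists2 Delta0 : R, 0 < Delta0 &
    forall p, Pset Delta0 Delta0 p `<=` ball p eps.

Definition C2 (d1 d2 : R) p : Prop := ~ is_retract (Qset d1 d2 p) (Pset d1 d2 p).

Definition C3 (d1 d2 : R) p : Prop :=
  is_retract (Qset d1 d2 p) (Pset d1 d2 p `\` Tset d1 d2 p).

Definition C4 (alpha d1 d2 Delta : R) p : Prop :=
  exists2 s : X -> X, is_retraction (Pset d1 d2 p) (Pset d1 Delta p) s &
    forall q, Pset d1 Delta p q -> alpha * V (q, p) <= V (s q, p).

Context (f : X -> X).

Definition C5 (d1 d2 Delta : R) p : Prop :=
  f @` Pset d1 d2 p `<=` Int0P Delta Delta (f p) /\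
  f @^-1` Pset d1 d2 (f p) `<=` Int0P Delta Delta p.

Definition C6 (d1 d2 : R) p : Prop :=
  f @` Tset d1 d2 p `<=` Int0P d1 d2 (f p).

Definition C7 (d1 d2 Delta : R) p : Prop :=
  f @` Tset d1 Delta p `&` Qset d1 d2 (f p) = set0.

Definition C8 (d1 d2 : R) p : Prop :=
  f @` Pset d1 d2 p `&` bd0P d1 d2 (f p) `<=` Int0Q d1 d2 (f p).

Definition C9 (d1 d2 Delta : R) p : Prop :=
  f @` Sset d1 Delta p `&` Pset d1 d2 (f p) = set0.

End LyapunovSets.

(* Main.v *)
Require Import Defs.
From HB Require Import structures.
From mathcomp Require Import all_boot all_order all_algebra.
From mathcomp Require Import all_classical all_reals all_analysis.
From mathcomp Require Import lra.

(** The proof is a discrete version of the Wazewski retract principle.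

    Choose Delta so small that P(Delta, Delta, p) lies in the eps-ball at p and
    U is a neighborhood of (q, p) for each q in it, and let d1, d2 be the
    numbers that (C5)-(C9) provide for Delta.  It suffices
    to find r with f^k(r) in P_k := P(d1, d2, p_k) for all k <= m.

    (C5)-(C9) compare the sets at p with those at f(p).  What the argument uses
    of them has the form: every point of a closed set lies in an open set.  By
    compactness of X^3 it survives, with a uniform d, when f(p) is replaced by
    any point at distance less than d from it ([link_uniform]).  Hence it holds
    between p_k and p_(k+1) along every d-pseudotrajectory.

    Let N_k be the set of the points of P_k whose orbit stays in P_k, ..., P_m
    and ends in T_m ([staying]).  Then Q_k is a retract of P_k \ N_k for every
    k, by descending induction.  For k = m this is (C3).  For the step
    ([retract_pullback]), a retraction rho of P_(k+1) \ N_(k+1) onto Q_(k+1)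
    extends by the identity to the part of f(P_k) outside P_(k+1), because by
    (C8) an orbit crosses the boundary of P_(k+1) only through Q_(k+1), where
    rho is the identity.  Conjugating this map by f gives a map phi of
    P_k \ N_k into P(d1, Delta, p_k), by (C5) and (C9).  It fixes Q_k, as
    f sends Q_k outside P_(k+1) by (C9), and it avoids V = 0 by (C6) and
    (C7).  Following phi by the retraction of (C4), and then by that of (C3),
    yields the retraction of P_k \ N_k onto Q_k.

    If N_0 were empty, Q_0 would be a retract of P_0, against (C2).  Any point
    of N_0 shadows the pseudotrajectory. *)

Set Implicit Arguments.
Unset Strict Implicit.
Unset Printing Implicit Defensive.

Import Order.TTheory GRing.Theory Num.Theory.
Local Open Scope classical_set_scope.
Local Open Scope ring_scope.

(** * Continuity on subspaces and compactness *)

Lemma closed_preimage_within (S T : topologicalType) (A : set S) (h : S -> T)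
    (D : set T) :
  closed A -> {within A, continuous h} -> closed D ->
  closed (A `&` h @^-1` D).
Proof.
move=> cA ch cD; rewrite setIC closed_setIS//.
by move/continuous_closedP : ch; apply.
Qed.

Lemma within_continuousP (S T : topologicalType) (A : set S) (h : S -> T) :
  {within A, continuous h} <->
  forall x, A x -> forall N, nbhs (h x) N -> nbhs x [set y | A y -> N (h y)].
Proof. exact: subspace_continuousP. Qed.

Lemma continuous_comp_within (S T Y : topologicalType) (A : set S) (B : set T)
    (g : S -> T) (h : T -> Y) :
  {within A, continuous g} -> (forall x, A x -> B (g x)) ->
  {within B, continuous h} -> {within A, continuous (h \o g)}.
Proof.
move=> /within_continuousP cg AB /within_continuousP ch.
apply/within_continuousP => x Ax N /(ch _ (AB _ Ax)) hN.
by apply: filterS (cg _ Ax _ hN) => y + Ay; apply => //; exact: AB.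
Qed.

(** The two pieces need to agree only at points of [C] on the frontier of [C],
    as inside [C] and outside it one of them is locally the whole function.
    Closedness of [A] is not assumed: in the application, the points whose
    orbit stays until the end are removed from [A]. *)
Lemma continuous_paste_frontier (S T : topologicalType) (A C : set S)
    (g h : S -> T) :
  closed C ->
  {within A `&` C, continuous g} -> {within A, continuous h} ->
  (forall x, A x -> C x -> nbhs x C \/ g x = h x) ->
  {within A, continuous (fun x => if `[< C x >] then g x else h x)}.
Proof.
move=> cC /within_continuousP cg /within_continuousP ch gh.
apply/within_continuousP => x Ax N.
case: (asboolP (C x)) => [Cx Ngx|nCx Nhx].
  have gN := cg _ (conj Ax Cx) _ Ngx.
  have [nC|gxhx] := gh _ Ax Cx.
    move: nC gN; apply: filterS2 => y Cy Ny Ay.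
    by rewrite asboolT//; exact: Ny.
  rewrite gxhx in Ngx; move: gN (ch _ Ax _ Ngx); apply: filterS2 => y gNy hNy Ay.
  by case: asboolP => Cy; [exact: gNy|exact: hNy].
have : nbhs x (~` C) by apply: open_nbhs_nbhs; split => //; exact: closed_openC.
move: (ch _ Ax _ Nhx); apply: filterS2 => y Ny nCy Ay.
by rewrite asboolF//; exact: Ny.
Qed.

(** Near a point where [g] and [h] differ, their distance is bounded below, and
    near a point where they coincide [O] holds; compactness makes the bound
    uniform. *)
Lemma uniform_near_coincidence (R : realType) (X : metricType R)
    (Z : topologicalType) (g h : Z -> X) (O : set Z) :
  compact [set: Z] -> continuous g -> continuous h ->
  (forall z, g z = h z -> nbhs z O) ->
  exists2 d : R, 0 < d & forall z, mdist (g z) (h z) < d -> O z.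
Proof.
move=> /compact_near_coveringP cZ cg ch ghO.
have := cZ _ (0^'+) (fun (d : R) z => mdist (g z) (h z) < d -> O z) _ _.
case=> [z _|d /= d0 dO].
  have [gz|ghz] := eqVneq (g z) (h z).
    exists (O, setT) => /=; first by split; [exact: ghO|exact: filterT].
    by move=> [z' d] [].
  pose e := mdist (g z) (h z) / 3.
  have e0 : 0 < e by rewrite divr_gt0// mdist_gt0.
  exists ([set z' | ball (g z) e (g z') /\ ball (h z) e (h z')],
          [set d | d < e]) => /=.
    split; last exact: nbhs_right_lt.
    apply: filterI; [apply: cg|apply: ch]; exact: nbhsx_ballx.
  move=> [z' d] /= []; rewrite !ballEmdist /= => -[gz' hz'] de zz'.
  exfalso.
  have := metric_triangle (g z) (g z') (h z).
  have := metric_triangle (g z') (h z') (h z).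
  rewrite [mdist (h z') _]metric_sym.
  have : mdist (g z) (h z) = e * 3 by rewrite /e divfK.
  lra.
have d20 : 0 < d / 2 by rewrite divr_gt0.
exists (d / 2) => // z; apply: (dO (d / 2)) => //=.
rewrite sub0r normrN gtr0_norm//; lra.
Qed.

(** The shape in which each of the conditions (C5)-(C9) is seen to be stable
    under small changes of the points involved. *)
Lemma nbhs_implication (Z : topologicalType) (A B : set Z) (z : Z) :
  closed A -> (A z -> nbhs z B) -> nbhs z [set y | A y -> B y].
Proof.
move=> cA AB; have [/AB|nAz] := pselect (A z).
  by apply: filterS => y By _.
have : nbhs z (~` A) by apply: open_nbhs_nbhs; split => //; exact: closed_openC.
by apply: filterS => y nAy /nAy.
Qed.

(** * The sets defined by V and W, as the base point varies *)

Section LyapunovPair.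
Context (R : realType) (X : metricType R) (U : set (X * X)) (V W : X * X -> R).
Context (Uclosed : closed U).
Context (Vcont : {within U, continuous V}) (Wcont : {within U, continuous W}).

Lemma sub_Pset (a b a' b' : R) (p : X) :
  a <= a' -> b <= b' -> Pset U V W a b p `<=` Pset U V W a' b' p.
Proof.
by move=> aa bb q [Uq Va Wb]; split=> //;
  [exact: le_trans aa|exact: le_trans bb].
Qed.

Lemma closed_Pgraph (a b : R) : closed [set z | Pset U V W a b z.2 z.1].
Proof.
rewrite (_ : [set _ | _] =
  (U `&` V @^-1` [set x | x <= a]) `&` (U `&` W @^-1` [set x | x <= b])).
  by apply: closedI; apply: closed_preimage_within => //; exact: closed_le.
apply/seteqP; split => -[q p] /=; first by case.
by case=> -[? ?] [].
Qed.

Lemma closed_Pgraph_preimage (h : X * X -> R) (a b : R) (D : set R) :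
  {within U, continuous h} -> closed D ->
  closed [set z | Pset U V W a b z.2 z.1 /\ D (h (z.1, z.2))].
Proof.
move=> hc cD; rewrite (_ : [set _ | _] =
  [set z | Pset U V W a b z.2 z.1] `&` (U `&` h @^-1` D)).
  by apply: closedI; [exact: closed_Pgraph|exact: closed_preimage_within].
apply/seteqP; split => -[q p] /=; first by case=> -[].
by case=> ? [].
Qed.

Lemma closed_Pset (a b : R) (p : X) : closed (Pset U V W a b p).
Proof.
apply: (@preimage_closed _ _ (fun q : X => (q, p))
  [set z | Pset U V W a b z.2 z.1]).
  by move=> q _; apply: cvg_pair => //=; exact: cvg_cst.
exact: closed_Pgraph.
Qed.

(** [Int0P] may fail to be open at the points over the boundary of [U], hence
    the first hypothesis. *)
Lemma nbhs_Int0P (a b : R) (q p : X) :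
  nbhs (q, p) U -> Int0P U V W a b p q ->
  nbhs (q, p) [set z | Int0P U V W a b z.2 z.1].
Proof.
move=> nU [_ Va Wb].
have nV : nbhs (q, p) (~` (U `&` V @^-1` [set x | a <= x])).
  apply: open_nbhs_nbhs; split; last by move=> /= [_]; rewrite leNgt Va.
  by apply: closed_openC; apply: closed_preimage_within => //; exact: closed_ge.
have nW : nbhs (q, p) (~` (U `&` W @^-1` [set x | b <= x])).
  apply: open_nbhs_nbhs; split; last by move=> /= [_]; rewrite leNgt Wb.
  by apply: closed_openC; apply: closed_preimage_within => //; exact: closed_ge.
move: nU nV nW; apply: filterS3 => -[y r] /= Uz nVz nWz.
have Vz : V (y, r) < a by rewrite ltNge; apply/negP => ?; exact: nVz.
have Wz : W (y, r) < b by rewrite ltNge; apply/negP => ?; exact: nWz.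
by split=> //; split=> //; exact: ltW.
Qed.

Context (f : X -> X).

(** * Passing from f(p) to nearby points *)

(** What the retraction argument uses of (C5)-(C9), with [r] in place of [f p].
    The first clause joins the second half of (C5) with (C9), the others come
    from (C6), (C7) and (C8). *)
Definition link (d1 d2 D : R) (p r : X) (q : X) : Prop :=
  [/\ Pset U V W d1 d2 r (f q) -> Pset U V W D D p q /\ V (q, p) < d1,
      Tset U V W d1 d2 p q -> Pset U V W d1 d2 r (f q),
      Tset U V W d1 D p q -> ~ Qset U V W d1 d2 r (f q) &
      Pset U V W d1 d2 p q -> Pset U V W d1 d2 r (f q) -> W (f q, r) < d2].

(** The hypothesis on [Pset U V W D D] keeps the sets away from the boundary of
    [U], so that the strict inequalities are open conditions. *)
Lemma link_uniform (d1 d2 D : R) :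
  compact [set: X] -> continuous f ->
  (forall p q, Pset U V W D D p q -> nbhs (q, p) U) ->
  d1 < D -> d2 < D ->
  (forall p, [/\ C5 U V W f d1 d2 D p, C6 U V W f d1 d2 p,
      C7 U V W f d1 d2 D p, C8 U V W f d1 d2 p & C9 U V W f d1 d2 D p]) ->
  exists2 d : R, 0 < d &
    forall p r, mdist r (f p) < d -> forall q, link d1 d2 D p r q.
Proof.
move=> Xc fc nU d1D d2D HC.
have Zc : compact [set: (X * X) * X].
  by rewrite -setXTT; apply: compact_setX => //;
    rewrite -setXTT; exact: compact_setX.
pose qp (z : (X * X) * X) := (z.1.1, z.1.2).
pose fqr (z : (X * X) * X) := (f z.1.1, z.2).
have qpc : continuous qp.
  move=> z; apply: cvg_pair => /=.
    by apply: (@continuous_comp _ _ _ fst fst); exact: cvg_fst.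
  by apply: (@continuous_comp _ _ _ fst snd); [exact: cvg_fst|exact: cvg_snd].
have fqrc : continuous fqr.
  move=> z; apply: cvg_pair => /=; last exact: cvg_snd.
  apply: (@continuous_comp _ _ _ (fun z : _ * X => z.1.1) f);
    last exact: fc.
  by apply: (@continuous_comp _ _ _ fst fst); exact: cvg_fst.
have cl (h : (X * X) * X -> X * X) (A : set (X * X)) :
    continuous h -> closed A -> closed (h @^-1` A).
  by move=> hc; move/continuous_closedP : hc; apply.
have [|||d d0 dO] := @uniform_near_coincidence R X _ snd (fun z => f z.1.2)
  [set z | link d1 d2 D z.1.2 z.2 z.1.1] Zc.
- by move=> z; exact: cvg_snd.
- move=> z; apply: (@continuous_comp _ _ _ (fun z : _ * X => z.1.2) f);
    last exact: fc.
  by apply: (@continuous_comp _ _ _ fst snd); [exact: cvg_fst|exact: cvg_snd].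
- move=> [[q p] r] /= ->{r}; have [[_ c5] c6 c7 c8 c9] := HC p.
  pose z : (X * X) * X := ((q, p), f p).
  have cPr := cl _ _ fqrc (@closed_Pgraph d1 d2).
  have cTp b := cl _ _ qpc
    (@closed_Pgraph_preimage V d1 b [set x | x = 0] Vcont (@closed_eq _ 0)).
  have nonexit : nbhs z [set z | Pset U V W d1 d2 z.2 (f z.1.1) ->
      Int0P U V W D D z.1.2 z.1.1].
    apply: (@nbhs_implication _ _
      [set z | Int0P U V W D D z.1.2 z.1.1] _ cPr) => /= Pz.
    apply: (qpc z [set z | Int0P U V W D D z.2 z.1]).
    by apply: nbhs_Int0P; [apply: nU; have [] := c5 q Pz|exact: c5].
  have slow : nbhs z [set z |
      Pset U V W D D z.1.2 z.1.1 /\ d1 <= V (z.1.1, z.1.2) ->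
      ~ Pset U V W d1 d2 z.2 (f z.1.1)].
    apply: (@nbhs_implication _ _
      [set z | ~ Pset U V W d1 d2 z.2 (f z.1.1)] _
      (cl _ _ qpc (@closed_Pgraph_preimage V D D [set x | d1 <= x]
        Vcont (@closed_ge _ _)))) => /= Sz.
    apply: open_nbhs_nbhs; split; first exact: closed_openC.
    move=> Pz; suff : set0 (f q) by [].
    by rewrite -c9; split=> //; exists q.
  have zero : nbhs z [set z | Tset U V W d1 d2 z.1.2 z.1.1 ->
      Int0P U V W d1 d2 z.2 (f z.1.1)].
    apply: (@nbhs_implication _ _
      [set z | Int0P U V W d1 d2 z.2 (f z.1.1)] _ (cTp d2)) => /= Tz.
    apply: (fqrc z [set z | Int0P U V W d1 d2 z.2 z.1]).
    have If : Int0P U V W d1 d2 (f p) (f q) by apply: c6; exists q.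
    by apply: nbhs_Int0P => //; apply: nU;
      apply: (sub_Pset (ltW d1D) (ltW d2D)); case: If.
  have zeroQ : nbhs z [set z | Tset U V W d1 D z.1.2 z.1.1 ->
      ~ Qset U V W d1 d2 z.2 (f z.1.1)].
    apply: (@nbhs_implication _ _
      [set z | ~ Qset U V W d1 d2 z.2 (f z.1.1)] _ (cTp D)) => /= Tz.
    apply: open_nbhs_nbhs; split.
      apply: closed_openC.
      exact: (cl _ _ fqrc (@closed_Pgraph_preimage V d1 d2 [set x | x = d1]
        Vcont (@closed_eq _ _))).
    move=> Qz; suff : set0 (f q) by [].
    by rewrite -c7; split=> //; exists q.
  have exitV : nbhs z [set z | Pset U V W d1 d2 z.1.2 z.1.1 ->
      ~ (Pset U V W d1 d2 z.2 (f z.1.1) /\ W (f z.1.1, z.2) = d2)].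
    apply: (@nbhs_implication _ _ [set z |
      ~ (Pset U V W d1 d2 z.2 (f z.1.1) /\ W (f z.1.1, z.2) = d2)] _
      (cl _ _ qpc (@closed_Pgraph d1 d2))) => /= Pz.
    apply: open_nbhs_nbhs; split.
      apply: closed_openC.
      exact: (cl _ _ fqrc (@closed_Pgraph_preimage W d1 d2 [set x | x = d2]
        Wcont (@closed_eq _ _))).
    move=> [Pfz Wz].
    have [] : Int0Q U V W d1 d2 (f p) (f q).
      by apply: c8; split; [exists q|right].
    by rewrite Wz ltxx.
  apply: filterS (filterI (filterI nonexit slow)
    (filterI zero (filterI zeroQ exitV))).
  move=> [[y s] r] /= [[ne sl] [ze [zq eV]]]; split => //.
  + move=> Pf; have [Py _ _] := ne Pf; split=> //.
    by rewrite ltNge; apply/negP => Vy; exact: sl Pf.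
  + by move=> /ze[].
  + move=> Py Pf; rewrite lt_neqAle; apply/andP; split; last by case: Pf.
    by apply/eqP => Wf; exact: eV Py _.
- by exists d => // p r pr q; exact: (dO ((q, p), r)).
Qed.

(** * The retraction argument *)

(** The inductive step, applied with [N] the set of points that stay until the
    end, seen one step later. *)
Lemma retract_pullback (g : X -> X) (d1 d2 D alpha : R) (p r : X) (N : set X) :
  continuous f -> continuous g -> cancel f g -> cancel g f ->
  (forall z, U z -> 0 <= V z) ->
  (forall q, Pset U V W d1 d2 r q -> nbhs (q, r) U) ->
  d1 < D -> d2 < D -> 0 < alpha -> N `<=` Pset U V W d1 d2 r ->
  (forall q, link d1 d2 D p r q) ->
  C3 U V W d1 d2 p -> C4 U V W alpha d1 d2 D p ->
  is_retract (Qset U V W d1 d2 r) (Pset U V W d1 d2 r `\` N) ->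
  is_retract (Qset U V W d1 d2 p)
             (Pset U V W d1 d2 p `\` (Pset U V W d1 d2 p `&` f @^-1` N)).
Proof.
move=> fc gc fK gK V0 nU d1D d2D a0 NP Hl.
move=> [tau [QPT tauc tauQ tauid]] [sigma [_ sigc sigP sigid] sigV].
move=> [rho [QPN rhoc rhoQ rhoid]].
pose C := f @^-1` Pset U V W d1 d2 r.
pose A := Pset U V W d1 d2 p `\` (Pset U V W d1 d2 p `&` f @^-1` N).
(* The conjugate by f of rho on P_r, extended by the identity outside P_r. *)
pose phi x := if `[< C x >] then g (rho (f x)) else x.
have AN x : A x -> ~ N (f x) by move=> [Px nPN] Nfx; exact: nPN.
have phic : {within A, continuous phi}.
  have contW (h : X -> X) B : continuous h -> {within B, continuous h}.
    by move=> hc; apply: continuous_subspaceT.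
  apply: (@continuous_paste_frontier _ _ A C (fun x => g (rho (f x))) id).
  - by move/continuous_closedP : fc; apply; exact: closed_Pset.
  - apply: (@continuous_comp_within _ _ _ _ setT (fun x => rho (f x)) g) => //.
      apply: (@continuous_comp_within _ _ _ _
        (Pset U V W d1 d2 r `\` N) f rho) => //.
        exact: contW.
      by move=> x [/AN].
    exact: contW.
  - by apply: contW => x; exact: cvg_id.
  (* f x on the frontier of P_r has V = d1, and rho fixes Q_r; when V < d1, f x
     is interior to P_r. *)
  move=> x Ax Cx; have [Px _] := Ax; have [_ _ _ /(_ Px Cx) Wx] := Hl x.
  have [_ Vle _] := Cx.
  have [VE|Vneq] := eqVneq (V (f x, r)) d1.
    by right; rewrite rhoid ?fK.
  left.
  have fcr : (fun y => (f y, r)) @ x --> (f x, r).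
    by apply: cvg_pair => /=; [exact: fc|exact: cvg_cst].
  have : nbhs x [set y | Int0P U V W d1 d2 r (f y)].
    apply: (fcr [set z | Int0P U V W d1 d2 z.2 z.1]).
    apply: nbhs_Int0P; first exact: nU.
    by split => //; rewrite lt_neqAle Vneq.
  by apply: filterS => y [].
have phiP x : A x -> Pset U V W d1 D p (phi x) /\ 0 < V (phi x, p).
  move=> Ax; have [Px _] := Ax; rewrite /phi; case: asboolP => Cx.
    have Qy : Qset U V W d1 d2 r (f (g (rho (f x)))).
      by rewrite gK; apply: rhoQ; split=> //; exact: AN.
    have [ne _ zQ _] := Hl (g (rho (f x))).
    have [[Uy Vy Wy] Vlt] := ne Qy.1.
    have PD : Pset U V W d1 D p (g (rho (f x))) by split=> //; exact: ltW.
    split=> //; rewrite lt_neqAle V0// andbT eq_sym; apply/eqP => V0y.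
    by apply: zQ Qy; split.
  have [Ux _ _] := Px.
  split; first exact: (sub_Pset (lexx _) (ltW d2D)).
  rewrite lt_neqAle V0// andbT eq_sym; apply/eqP => V0x.
  by have [_ ze _ _] := Hl x; apply: Cx; apply: ze.
have sphi x : A x -> (Pset U V W d1 d2 p `\` Tset U V W d1 d2 p) (sigma (phi x)).
  move=> /phiP[Pphi Vphi]; split; first exact: sigP.
  move=> [_ Vs]; have := sigV _ Pphi; rewrite Vs leNgt => /negP; apply.
  exact: mulr_gt0.
have QC x : Qset U V W d1 d2 p x -> ~ C x.
  move=> [_ Vx] Cx; have [/(_ Cx)[_]] := Hl x.
  by rewrite Vx ltxx.
exists (fun x => tau (sigma (phi x))); split.
- by move=> x Qx; split; [exact: Qx.1|move=> [_ /NP/(QC x Qx)]].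
- apply: (@continuous_comp_within _ _ _ A _ (sigma \o phi) tau) tauc => //.
  by apply: (@continuous_comp_within _ _ _ A _ phi sigma) sigc => // x /phiP[].
- by move=> x /sphi; exact: tauQ.
- move=> x Qx; rewrite /phi asboolF; last exact: QC.
  by rewrite sigid ?tauid//; exact: Qx.1.
Qed.

(** The end point is asked to lie in the set V = 0, and not just in the last
    [Pset], so that (C3) starts the induction. *)
Fixpoint staying (d1 d2 : R) (m : nat) (p : nat -> X) : set X :=
  if m is m'.+1
  then Pset U V W d1 d2 (p 0) `&` f @^-1` staying d1 d2 m' (fun k => p k.+1)
  else Tset U V W d1 d2 (p 0).

Lemma staying_sub (d1 d2 : R) m p :
  staying d1 d2 m p `<=` Pset U V W d1 d2 (p 0).
Proof. by case: m => [|m] x /= []. Qed.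

Lemma staying_iter (d1 d2 : R) m p x k : staying d1 d2 m p x -> (k <= m)%N ->
  Pset U V W d1 d2 (p k) (iter k f x).
Proof.
elim: k m p x => [|k IH] [|m] p x //; first by move=> /staying_sub.
  by move=> /staying_sub.
by move=> [_ Nx] km; rewrite iterSr; exact: (IH m (fun k => p k.+1)).
Qed.

End LyapunovPair.

(** * Finite shadowing *)

Theorem theorem1 (R : realType) (X : metricType R)
  (Xcompact : compact [set: X])
  (f : X -> X) (fhomeo : homeomorphism f)
  (U : set (X * X)) (Unbhs : closed_nbhs_diagonal U)
  (V W : X * X -> R)
  (Vcont : {within U, continuous V}) (Wcont : {within U, continuous W})
  (Vge0 : forall z, U z -> 0 <= V z) (Wge0 : forall z, U z -> 0 <= W z)
  (Vdiag : forall p, V (p, p) = 0) (Wdiag : forall p, W (p, p) = 0)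
  (HC1 : C1 U V W)
  (HC29 : exists Delta1 : R, [/\ 0 < Delta1,
    (forall d1 d2 Delta : R,
       0 < d1 < Delta1 -> 0 < d2 < Delta1 -> 0 < Delta < Delta1 ->
       d2 < Delta ->
       exists2 alpha : R, 0 < alpha &
         forall p : X, [/\ C2 U V W d1 d2 p, C3 U V W d1 d2 p &
                           C4 U V W alpha d1 d2 Delta p]) &
    (forall Delta : R, 0 < Delta < Delta1 ->
       exists d1 d2 : R, [/\ 0 < d1 < Delta, 0 < d2 < Delta &
         forall p : X, [/\ C5 U V W f d1 d2 Delta p, C6 U V W f d1 d2 p,
                           C7 U V W f d1 d2 Delta p, C8 U V W f d1 d2 p &
                           C9 U V W f d1 d2 Delta p]])]) :
  finite_shadowing f.
Proof.
move=> eps eps0.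
have [fc [g [gc fK gK]]] := fhomeo; have [Uclosed Udiag] := Unbhs.
have [Delta1 [D10 H24 H59]] := HC29.
have [eta eta0 etaU] : exists2 eta : R, 0 < eta &
    forall z : X * X, mdist z.1 z.2 < eta -> nbhs z U.
  apply: uniform_near_coincidence.
  - by rewrite -setXTT; exact: compact_setX.
  - by move=> z; exact: cvg_fst.
  - by move=> z; exact: cvg_snd.
  - move=> [q p] /= ->; have := nbhs_interior (Udiag p).
    by apply: filterS => z; rewrite /interior.
have min0 : 0 < Num.min eps eta by rewrite lt_min eps0.
have [D0 D00 D0P] := HC1 _ min0.
pose D := Num.min D0 Delta1 / 2.
have Dmin0 : 0 < Num.min D0 Delta1 by rewrite lt_min D00.
have Dmin : D < Num.min D0 Delta1 by rewrite /D; lra.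
have Dpos : 0 < D by rewrite divr_gt0.
have [DD0 DD1] : D < D0 /\ D < Delta1 by move: Dmin; rewrite lt_min => /andP.
have [d1 [d2 [/andP[d10 d1D] /andP[d20 d2D] HC]]] :=
  H59 D (introT andP (conj Dpos DD1)).
have [|||//|alpha a0 HA] := H24 d1 d2 D.
- by rewrite d10 (lt_trans d1D).
- by rewrite d20 (lt_trans d2D).
- by rewrite Dpos.
have PDball p q : Pset U V W D D p q -> mdist q p < eps /\ mdist q p < eta.
  move=> /(sub_Pset (ltW DD0) (ltW DD0))/D0P.
  by rewrite ballEmdist /= lt_min metric_sym => /andP.
have PDnbhs p q : Pset U V W D D p q -> nbhs (q, p) U.
  by move=> /PDball[_ ?]; exact: etaU.
have PP p : Pset U V W d1 d2 p `<=` Pset U V W D D p.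
  by apply: sub_Pset; exact: ltW.
have [d d0 dlink] := link_uniform Uclosed Vcont Wcont Xcompact fc
  PDnbhs d1D d2D HC.
exists d => // m p pseudo.
have retr : is_retract (Qset U V W d1 d2 (p 0%N))
    (Pset U V W d1 d2 (p 0%N) `\` staying U V W f d1 d2 m p).
  elim: m p pseudo => [|m IH] p pseudo; first by have [_ + _] := HA (p 0%N).
  have [_ c3 c4] := HA (p 0%N).
  apply: (@retract_pullback _ _ _ _ _ _ _ _ _ g _ _ D alpha _ (p 1%N)) => //.
  - by move=> q /PP/PDnbhs.
  - exact: staying_sub.
  - by apply: dlink; exact: pseudo.
  - by apply: IH => k km; exact: pseudo.
have [empty|/set0P[x Nx]] := eqVneq (staying U V W f d1 d2 m p) set0.
  by have [c2 _ _] := HA (p 0%N); case: c2; rewrite empty setD0 in retr.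
exists x => k km.
by have [] := PDball _ _ (PP _ _ (staying_iter Nx km)).
Qed.
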